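(* Let $k, n, p, r$ be integers with $2k+1=(2^n-1)p+r$, where $p\ge 1$, $n\ge 2$, and $0\le r\le 2^n-2$. Then \[ \chi(K^2(2k+1,k))\le \begin{cases} 2^n p = 2k+1+p, & \text{if } r=0,\\ 2^n(p+1) = 2k+1+p-r+2^n, & \text{if } r \text{ is odd},\\ 2^n(p+2) = 2k+1+p-r+2^{n+1}, & \text{if } r \text{ is even and } r\neq 0. \end{cases} \]
   Context: For integers $m\ge 2k$, the Kneser graph $K(m,k)$ is the graph whose vertices are the $k$-element subsets of a fixed $m$-element set, two vertices $A,B$ being adjacent if and only if $A\cap B=\emptyset$. The square $G^2$ of a simple graph $G$ has vertex set $V(G)$, and two distinct vertices are adjacent in $G^2$ if and only if their distance in $G$ is at most $2$. $K^2(m,k)$ denotes the square of $K(m,k)$, and $\chi$ denotes the chromatic number. *)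

(* Defs.v *)
From mathcomp Require Import all_boot.

Set Implicit Arguments.
Unset Strict Implicit.
Unset Printing Implicit Defensive.

Record sgraph := SGraph {
  vertex :> finType;
  edge : rel vertex;
  edge_sym : symmetric edge;
  edge_irrefl : irreflexive edge
}.

Arguments edge {G} x y : rename.

Definition has_walk (G : sgraph) (x y : G) (d : nat) : bool :=
  [exists p : d.-tuple G, path edge x p && (last x p == y)].

Lemma connect_has_walk (G : sgraph) (x y : G) :
  connect edge x y -> exists d, has_walk x y d.
Proof.
case/connectP => p Hp ->; exists (size p).
by apply/existsP; exists (in_tuple p); rewrite Hp eqxx.
Qed.

(* The distance is infinite, encoded as None, between vertices in different
   components. *)
Definition dist (G : sgraph) (x y : G) : option nat :=
  if @idP (connect edge x y) is ReflectT xy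
  then Some (ex_minn (connect_has_walk xy)) else None.

Definition dist_le (G : sgraph) (x y : G) (d : nat) : bool :=
  if dist x y is Some e then e <= d else false.

Section Square.

Variable G : sgraph.

Definition square_edge : rel G := fun x y => (x != y) && dist_le x y 2.

Lemma has_walk_sym (x y : G) (d : nat) : has_walk x y d = has_walk y x d.
Proof.
wlog suff H : x y / has_walk x y d -> has_walk y x d.
  by apply/idP/idP; apply: H.
case/existsP => p /andP[Hp /eqP Hl]; apply/existsP.
have Hs : size (rev (belast x p)) == d by rewrite size_rev size_belast size_tuple.
exists (Tuple Hs); rewrite /= -{1}Hl rev_path.
rewrite (eq_path (e' := edge)); last by move=> a b; rewrite edge_sym.
rewrite Hp /=; case: (tval p) Hl => [|a q] /= Hl; first by rewrite Hl.
by rewrite rev_cons last_rcons.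
Qed.

Lemma dist_sym (x y : G) : dist x y = dist y x.
Proof.
have C : connect edge x y = connect edge y x.
  by apply: sym_connect_sym; exact: edge_sym.
rewrite /dist; case: {-}_ / idP => c; case: {-}_ / idP => c'.
- congr Some; case: ex_minnP => d Hd Md; case: ex_minnP => e He Me.
  by apply/eqP; rewrite eqn_leq Md ?Me // has_walk_sym.
- by case: c'; rewrite -C.
- by case: c; rewrite C.
- by [].
Qed.

Lemma square_edge_sym : symmetric square_edge.
Proof. by move=> x y; rewrite /square_edge /dist_le eq_sym dist_sym. Qed.

Lemma square_edge_irrefl : irreflexive square_edge.
Proof. by move=> x; rewrite /square_edge eqxx. Qed.

Definition square : sgraph := SGraph square_edge_sym square_edge_irrefl.

End Square.

Section Kneser.

Variables m k : nat.

Definition ksubset : finType := {A : {set 'I_m} | #|A| == k}.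

(* The condition A != B is implied by disjointness unless k = 0, where it
   rules out a loop at the empty set. *)
Definition kneser_edge : rel ksubset :=
  fun A B => (A != B) && (val A :&: val B == set0).

Lemma kneser_edge_sym : symmetric kneser_edge.
Proof. by move=> A B; rewrite /kneser_edge eq_sym setIC. Qed.

Lemma kneser_edge_irrefl : irreflexive kneser_edge.
Proof. by move=> A; rewrite /kneser_edge eqxx. Qed.

Definition kneser : sgraph := SGraph kneser_edge_sym kneser_edge_irrefl.

End Kneser.

Section Chromatic.

Variable G : sgraph.

Definition colorable (c : nat) : bool :=
  [exists f : {ffun G -> 'I_c},
    [forall x, forall y, edge x y ==> (f x != f y)]].

Lemma colorable_ex : exists c, colorable c.
Proof.
exists #|G|; apply/existsP; exists [ffun x => enum_rank x].
apply/forallP => x; apply/forallP => y; apply/implyP => xy; rewrite !ffunE.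
by apply: contraTneq xy => /enum_rank_inj ->; rewrite edge_irrefl.
Qed.

Definition chromatic_number : nat := ex_minn colorable_ex.

End Chromatic.

(* Main.v *)
(** Label the 2k+1 points injectively by a set [E] of elements of a finite
    abelian group and colour a k-set by the sum of its labels. Distinct k-sets
    at distance 2 in K(2k+1,k) differ by exchanging one point, so their sums
    differ. Disjoint k-sets miss exactly one point x, so equal sums g would
    give 2g = S - x with S the total sum. In the group F * Z/q, where F is the
    field with 2^n elements, 2g has zero first coordinate; so it is enough that
    labels have nonzero first coordinate and that the first coordinates of [E]
    sum to zero. The nonzero elements of F sum to zero for n >= 2, and removing
    d pairs (v, i), (v, j) from (F \ 0) * Z/q preserves this. *)

From HB Require Import structures.
Require Import Defs.
From mathcomp Require Import all_boot.
From mathcomp Require Import all_algebra finfield.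
From mathcomp Require Import zify.

Import GRing.Theory.

(** Joins the finite and the additive structure of a product, so that [F * 'I_q.+1] can serve as a
    [finZmodType]. *)
HB.instance Definition _ (A B : finZmodType) := GRing.Zmodule.on (A * B)%type.

Lemma walk_le2 (G : sgraph) (x y : G) :
  x != y -> dist_le x y 2 ->
  edge x y \/ exists2 z : G, edge x z & edge z y.
Proof.
move=> nxy; rewrite /dist_le /dist; case: {-}_ / idP => // c.
case: ex_minnP => d /existsP[p /andP[]].
case: p => [[|a [|b [|e s]]] /= /eqP <-] //=.
- by rewrite (negPf nxy).
- by rewrite andbT => xa /eqP <- _ _; left.
- by case/and3P=> xa ab _ /eqP <- _ _; right; exists a.
Qed.

Lemma chromatic_number_le (G : sgraph) (T : finType) (f : G -> T) :
  (forall x y, edge x y -> f x != f y) -> chromatic_number G <= #|T|.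
Proof.
move=> fP; rewrite /chromatic_number; case: ex_minnP => c _; apply.
apply/existsP; exists [ffun x => enum_rank (f x)].
apply/forallP => x; apply/forallP => y; apply/implyP => /fP.
by rewrite !ffunE; apply: contra => /eqP /enum_rank_inj ->.
Qed.

Section LabelSum.
Local Open Scope ring_scope.

Lemma chromatic_square_kneser_le (k : nat) (G : finZmodType) (E : {set G}) :
  #|E| = (2 * k + 1)%N ->
  (forall g x, x \in E -> g + g != \sum_(y in E) y - x) ->
  (chromatic_number (square (kneser (2 * k + 1) k)) <= #|G|)%N.
Proof.
move=> cE E2; pose f i := enum_val (cast_ord (esym cE) i).
have f_inj : injective f by move=> i j /enum_val_inj /cast_ord_inj.
have sumf : \sum_i f i = \sum_(y in E) y.
  rewrite (big_enum_val (fun y => y)) (reindex (cast_ord (esym cE))) //.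
  by exists (cast_ord cE) => i _; rewrite ?cast_ordK ?cast_ordKV.
pose c (A : ksubset (2 * k + 1) k) := \sum_(i in val A) f i.
apply: (@chromatic_number_le (square (kneser _ k)) G c) => A B.
case/andP=> nAB /(walk_le2 _ _ _ nAB).
have cA : #|val A| = k := eqP (valP A).
have cB : #|val B| = k := eqP (valP B).
case=> [/andP[_ /eqP AB0]|[C /andP[_ /eqP AC0] /andP[_ /eqP CB0]]].
- have cU : #|val A :|: val B| = (2 * k)%N.
    by rewrite cardsU AB0 cards0 cA cB; lia.
  have /cards1P[a Ea] : #|~: (val A :|: val B)| == 1%N.
    by have := cardsC (val A :|: val B); rewrite cU card_ord; lia.
  have BDA : val B :\: val A = val B.
    by apply/setDidPl; rewrite disjoint_sym -setI_eq0 AB0.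
  have sumAB : \sum_i f i = c A + c B + f a.
    rewrite (bigID (mem (val A :|: val B))) /=; congr (_ + _).
      by rewrite (big_setID (val A)) /= setUK setDUl setDv set0U BDA.
    by rewrite -[f a](big_set1 +%R a) -Ea; apply: eq_bigl => i; rewrite in_setC.
  apply: contraNneq (E2 (c A) (f a) (enum_valP _)) => eAB.
  by rewrite -sumf sumAB addrK -eAB.
- have cC : #|val C| = k := eqP (valP C).
  (* Both sets lie in the complement of their common neighbour [C], which has only k + 1 points;
     being distinct k-sets, they differ by one point each way. *)
  have sAC : val A \subset ~: val C by rewrite -disjoints_subset -setI_eq0 AC0.
  have sBC : val B \subset ~: val C.
    by rewrite -disjoints_subset -setI_eq0 setIC CB0.
  have cU : (#|val A :|: val B| <= k.+1)%N.
    have := cardsC (val C); rewrite cC card_ord => cCC.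
    by apply: leq_trans (subset_leq_card (_ : _ \subset ~: val C)) _;
      [rewrite subUset sAC | lia].
  have cI : (#|val A :&: val B| < k)%N.
    have cIA := subset_leq_card (subsetIl (val A) (val B)).
    rewrite cA in cIA; rewrite ltn_neqAle cIA andbT.
    apply: contra nAB => /eqP cI; apply/eqP/val_inj/eqP.
    have AI : val A :&: val B = val A.
      by apply/eqP; rewrite eqEcard subsetIl cI cA leqnn.
    by rewrite eqEcard cA cB leqnn andbT; apply/setIidPl.
  rewrite cardsU cA cB in cU.
  have /cards1P[a Ea] : #|val A :\: val B| == 1%N by rewrite cardsD cA; lia.
  have /cards1P[b Eb] : #|val B :\: val A| == 1%N.
    by rewrite cardsD cB setIC; lia.
  have ab : a != b.
    have : a \in val A :\: val B by rewrite Ea set11.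
    have : b \in val B :\: val A by rewrite Eb set11.
    by rewrite !inE => /andP[_ bB] /andP[aB _]; apply: contraNneq aB => ->.
  (* The sum over the common part cancels, leaving the labels of the two exchanged points. *)
  rewrite /c (big_setID (val B)) /= [X in _ != X](big_setID (val A)) /=.
  rewrite Ea Eb !big_set1 setIC; apply: contra ab => /eqP/addrI/f_inj ->.
  exact: eqxx.
Qed.

(* The sum is invariant under multiplication by any c <> 0, 1. *)
Lemma sum_finField_eq0 (F : finFieldType) :
  (2 < #|F|)%N -> \sum_(x : F) x = 0.
Proof.
move=> cF; have [c] : exists c : F, c \notin [set 0; 1].
  apply/existsP; rewrite -negb_forall; apply: contraL cF => /forallP sF.
  have sF2 : [set: F] \subset [set 0; 1] by apply/subsetP => x _; apply: sF.
  rewrite -leqNgt -cardsT (leq_trans (subset_leq_card sF2)) // cards2.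
  by case: eqP.
rewrite !inE negb_or => /andP[c0 c1]; apply/eqP.
have : \sum_(x : F) x == c * \sum_(x : F) x.
  rewrite mulr_sumr; apply/eqP/reindex_inj; exact: mulfI.
rewrite -subr_eq0 -{1}[\sum_x x]mul1r -mulrBl mulf_eq0 subr_eq0 eq_sym.
by rewrite (negPf c1).
Qed.

Lemma exists_subset_card (T : finType) (A : {set T}) (d : nat) :
  (d <= #|A|)%N -> exists2 B : {set T}, B \subset A & #|B| = d.
Proof.
case/card_geqP => s [us <- sA]; exists [set x in s].
  by apply/subsetP => x; rewrite inE => /sA.
by rewrite cardsE; exact/card_uniqP.
Qed.

(** Here [d] counts the removed pairs: the bound [d <= 2 ^ n - 1] leaves a different nonzero [v] for
    each pair, and [1 < q] provides two distinct second coordinates. *)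
Lemma chromatic_square_kneser_pow2 (k n q d : nat) :
  (1 < n)%N -> (2 * k + 1 + 2 * d = (2 ^ n - 1) * q)%N -> (d <= 2 ^ n - 1)%N ->
  (0 < d -> 1 < q)%N ->
  (chromatic_number (square (kneser (2 * k + 1) k)) <= 2 ^ n * q)%N.
Proof.
move=> n1 kE dle q1.
have [F charF cF] := PrimePowerField (isT : prime 2) (ltnW n1).
case: q kE q1 => [|q] kE q1; first by lia.
have cN : #|[set~ (0 : F)]| = (2 ^ n - 1)%N by rewrite cardsC1 cF; lia.
have [D sD cD] : exists2 D : {set F}, D \subset [set~ 0] & #|D| = d.
  by apply: exists_subset_card; rewrite cN.
(* The factor [d] admits an empty [J] when nothing is removed, since [q] may then be 1. *)
have [J cJ] : exists J : {set 'I_q.+1}, (d * #|J| = d * 2)%N.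
  case: (posnP d) => [->|/q1 q2]; first by exists set0.
  have [|J _ cJ] := exists_subset_card _ [set: 'I_q.+1] 2; last first.
    by exists J; rewrite cJ.
  by rewrite cardsT card_ord.
pose N := setX [set~ (0 : F)] [set: 'I_q.+1].
pose W := setX D J.
have sWN : W \subset N by apply: setXS (subsetT J).
have sum0 (B : {set F}) (K : {set 'I_q.+1}) :
    \sum_(y in setX B K) y.1 = (\sum_(v in B) v) *+ #|K|.
  rewrite -sumrMnl -(eq_bigr _ (fun v _ => sumr_const (mem K) v)).
  by rewrite pair_big; apply: eq_bigl => -[v i]; rewrite !inE.
(* If [d > 0], each element of [D] occurs twice and cancels in characteristic 2. *)
have W0 : \sum_(y in W) y.1 = 0.
  rewrite sum0; case: (posnP d) => d0.
    by rewrite (cards0_eq (etrans cD d0)) big_set0 mul0rn.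
  have -> : #|J| = 2 by nia.
  by rewrite mulr2n addrr_pchar2.
have N0 : \sum_(y in N) y.1 = 0.
  rewrite sum0; suff -> : \sum_(v in [set~ (0 : F)]) v = 0 by rewrite mul0rn.
  rewrite -[RHS](@sum_finField_eq0 F); last first.
    by rewrite cF; apply: leq_trans (leq_pexp2l (isT : 0 < 2)%N n1).
  rewrite [RHS](bigD1 0) //= add0r; apply: eq_bigl => v.
  by rewrite !inE.
have -> : (2 ^ n * q.+1)%N = #|{: F * 'I_q.+1}| by rewrite card_prod cF card_ord.
apply: (@chromatic_square_kneser_le k (F * 'I_q.+1)%type (N :\: W)).
  rewrite cardsD (setIidPr sWN) !cardsX cN cardsT card_ord cD cJ; lia.
move=> [g1 g2] x; rewrite !inE !andbT => /andP[_ x0].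
apply: contraNneq x0 => /(congr1 fst) /=.
rewrite addrr_pchar2 // raddf_sum /=.
have : \sum_(y in N :\: W) y.1 = 0.
  by move: N0; rewrite (big_setID W) /= (setIidPr sWN) W0 add0r.
by move=> ->; rewrite add0r => /esym/eqP; rewrite oppr_eq0.
Qed.

End LabelSum.

Theorem theorem2p3 (k n p r : nat) :
  2 * k + 1 = (2 ^ n - 1) * p + r -> 1 <= p -> 2 <= n -> r <= 2 ^ n - 2 ->
  let chi := chromatic_number (square (kneser (2 * k + 1) k)) in
  [/\ r = 0 ->
        chi <= 2 ^ n * p /\ 2 ^ n * p = 2 * k + 1 + p,
      odd r ->
        chi <= 2 ^ n * (p + 1) /\
        2 ^ n * (p + 1) = 2 * k + 1 + p - r + 2 ^ n
    & ~~ odd r -> r <> 0 ->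
        chi <= 2 ^ n * (p + 2) /\
        2 ^ n * (p + 2) = 2 * k + 1 + p - r + 2 ^ n.+1].
Proof.
move=> kE p1 n2 rle chi.
have [h hE] : exists h, 2 ^ n = 2 * h.
  by exists (2 ^ n.-1); rewrite -expnS prednK // ltnW.
have h0 : 0 < h by have := expn_gt0 2 n; rewrite hE; lia.
have mulE q : (2 ^ n - 1) * q = 2 ^ n * q - q by rewrite mulnBl mul1n.
have leq_mulE q : q <= 2 ^ n * q by rewrite leq_pmull // expn_gt0.
have upper q d := @chromatic_square_kneser_pow2 k n q d n2.
have pE := leq_mulE p.
rewrite expnS; split=> [r0|rodd|reven r0]; split.
(* In each case [d] solves [(2 ^ n - 1) * q = 2 * k + 1 + 2 * d]. As [2 ^ n - 1] is odd, [q - p]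
   must have the parity of [r], whence the shifts 0, 1 and 2. In the last two cases [1 <= p] gives
   [1 < q]. *)
- by apply: (upper p 0); lia.
- by move: kE; rewrite mulE; lia.
- by apply: (upper (p + 1) (h - uphalf r)); move: kE rle; rewrite hE; lia.
- by move: kE; rewrite mulE mulnDr; lia.
- by apply: (upper (p + 2) (2 ^ n - 1 - r./2)); move: kE rle; rewrite hE; lia.
- by move: kE; rewrite mulE mulnDr; lia.
Qed.
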